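(* Let $\Sigma=(G,\sigma)$ be a signed graph whose underlying graph $G$ is finite, simple and connected. Then $\Sigma$ is distance-compatible if and only if every block of $\Sigma$ is distance-compatible.
   Context: A signed graph $\Sigma=(G,\sigma)$ consists of an underlying graph $G=(V,E)$ and a signature $\sigma:E\to\{1,-1\}$. The sign of a path is the product of the signs of its edges. A block of $\Sigma$ is a block of $G$ (a maximal connected subgraph having no cutpoint of its own) with the signature restricted to its edges; it is regarded as a signed graph in its own right. Let $d(u,v)$ be the usual graph distance in $G$. For vertices $u,v$, let $\sigma_{\max}(u,v)=-1$ if all shortest $uv$-paths have sign $-1$, and $+1$ otherwise; let $\sigma_{\min}(u,v)=+1$ if all shortest $uv$-paths have sign $+1$, and $-1$ otherwise. Put $d_{\max}(u,v)=\sigma_{\max}(u,v)d(u,v)$ and $d_{\min}(u,v)=\sigma_{\min}(u,v)d(u,v)$. Two vertices $u,v$ are distance-compatible if $d_{\min}(u,v)=d_{\max}(u,v)$, and a connected signed graph is distance-compatible if every two of its vertices are distance-compatible (equivalently, for every two vertices all shortest paths between them have the same sign). *)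

(* Defs.v *)
From mathcomp Require Import all_boot all_order all_algebra.
Set Implicit Arguments.
Unset Strict Implicit.
Unset Printing Implicit Defensive.
Import GRing.Theory Num.Theory.
Local Open Scope ring_scope.

(* The vertex set is a subset of an ambient finite type, so that a graph and
   all its (not necessarily induced) subgraphs have the same Rocq type. *)
Record graph (T : finType) := Graph {
  vertices : {set T};
  edges : {set {set T}};
  _ : [forall e in edges, (#|e| == 2%N) && (e \subset vertices)]
}.

Definition adj (T : finType) (G : graph T) : rel T :=
  [rel x y | [set x; y] \in edges G].

(* The path with vertex sequence u :: p, of length size p, from u to v. *)
Definition is_path (T : finType) (G : graph T) (u v : T) (p : seq T) : bool :=
  [&& u \in vertices G, path (adj G) u p, last u p == v & uniq (u :: p)].

Definition connected (T : finType) (G : graph T) : Prop :=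
  vertices G != set0 /\
  forall u v, u \in vertices G -> v \in vertices G -> exists p, is_path G u v p.

Definition subgraph (T : finType) (H G : graph T) : Prop :=
  vertices H \subset vertices G /\ edges H \subset edges G.

(* A vertex separating two other vertices of the same component. *)
Definition cutpoint (T : finType) (G : graph T) (c : T) : Prop :=
  c \in vertices G /\
  exists x y, [/\ x != c, y != c, exists p, is_path G x y p
                & forall p, is_path G x y p -> c \in x :: p].

Definition connected_no_cutpoint (T : finType) (G : graph T) : Prop :=
  connected G /\ forall c, ~ cutpoint G c.

Definition is_block (T : finType) (B G : graph T) : Prop :=
  [/\ subgraph B G, connected_no_cutpoint B
    & forall K, subgraph K G -> connected_no_cutpoint K ->
        subgraph B K -> subgraph K B].

(* A path has fewer than #|T| edges; the value is the dummy #|T| when there is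
   no path from u to v. *)
Definition dist (T : finType) (G : graph T) (u v : T) : nat :=
  find (fun n => [exists p : n.-tuple T, is_path G u v p]) (iota 0 #|T|).

(* The values of the signature off the edges are irrelevant. *)
Record signed_graph (T : finType) := SignedGraph {
  underlying :> graph T;
  signature : {set T} -> int;
  _ : forall e, e \in edges underlying -> signature e = 1 \/ signature e = -1
}.

Definition path_sign (T : finType) (S : signed_graph T) (u : T) (p : seq T) : int :=
  \prod_(e <- pairmap (fun x y => [set x; y]) u p) signature S e.

Definition sigma_max (T : finType) (S : signed_graph T) (u v : T) : int :=
  if [forall p : (dist S u v).-tuple T, is_path S u v p ==> (path_sign S u p == -1)]
  then -1 else 1.

Definition sigma_min (T : finType) (S : signed_graph T) (u v : T) : int :=
  if [forall p : (dist S u v).-tuple T, is_path S u v p ==> (path_sign S u p == 1)]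
  then 1 else -1.

Definition d_max (T : finType) (S : signed_graph T) (u v : T) : int :=
  sigma_max S u v * (dist S u v)%:Z.

Definition d_min (T : finType) (S : signed_graph T) (u v : T) : int :=
  sigma_min S u v * (dist S u v)%:Z.

Definition vertices_distance_compatible (T : finType) (S : signed_graph T)
    (u v : T) : Prop :=
  d_min S u v = d_max S u v.

Definition distance_compatible (T : finType) (S : signed_graph T) : Prop :=
  forall u v, u \in vertices S -> v \in vertices S ->
    vertices_distance_compatible S u v.

Definition is_signed_block (T : finType) (B S : signed_graph T) : Prop :=
  is_block B S /\ {in edges B, signature B =1 signature S}.

(* Main.v *)
Require Import Defs.
From mathcomp Require Import all_boot all_order all_algebra.

(** The proof rests on one property of blocks: a block [B] of [G] absorbs every
    path of [G] that joins two of its vertices ([block_path]).  Indeed, adding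
    such a path to [B] creates no cutpoint, since deleting a vertex leaves each
    surviving vertex of the path attached to one of the two ends of the path
    ([nonseparable_add_path]); so the enlarged graph lies in [B], by maximality.
    Consequently [B] and [G] have the same paths, the same distances and the
    same shortest paths between vertices of [B] ([block_geodesic]), and a block
    of a distance-compatible signed graph is distance-compatible.

    Conversely, suppose that all blocks are distance-compatible, and let [p] and
    [q] be shortest paths from [u] to [v].  If they meet at an inner vertex [w],
    they split at [w] into shortest paths from [u] to [w] and from [w] to [v],
    and induction on the length applies to both halves.  Otherwise [p] and [q]
    form a cycle or are the same edge, and both ends lie in the block that
    contains the first edge [ua] of [p]: going along [q] from [u] to [v] and
    then back along [p] to [a] is a path between two vertices of that block, so
    the block absorbs it ([disjoint_geodesics_in_block]).  Then [p] and [q] are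
    shortest paths of this block, hence have the same sign.

    Distance-compatibility enters only as the equality of the signs of any two
    shortest paths with the same ends ([distance_compatibleP]). *)

Set Implicit Arguments.
Unset Strict Implicit.
Unset Printing Implicit Defensive.
Import GRing.Theory Num.Theory.

(** * Connectedness after deleting at most one vertex *)

Section Graphs.

Variable T : finType.
Implicit Types (G H K B : graph T) (A : {set T}) (u v w x y : T) (p q : seq T).

Lemma edge_sub G e : e \in edges G -> e \subset vertices G.
Proof. by case: G => V E /= /forall_inP axE /axE /andP[]. Qed.

Lemma adj_sym G : symmetric (adj G).
Proof. by move=> x y; rewrite /adj /= setUC. Qed.

Lemma adj_vertices G x y :
  adj G x y -> x \in vertices G /\ y \in vertices G.
Proof.
move=> /edge_sub/subsetP sV.
by split; apply: sV; rewrite !inE eqxx ?orbT.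
Qed.

Lemma walk_vertices G u p :
  u \in vertices G -> path (adj G) u p -> {subset u :: p <= vertices G}.
Proof.
elim: p u => [|a p IHp] u uV /=; first by move=> _ x; rewrite inE => /eqP->.
case/andP=> /adj_vertices[_ aV] /(IHp a aV) sub x.
by rewrite inE => /predU1P[-> //|/sub].
Qed.

Lemma subgraph_adj H G : subgraph H G -> subrel (adj H) (adj G).
Proof. by case=> _ /subsetP sE x y; apply: sE. Qed.

Lemma subgraph_path H G u v p :
  subgraph H G -> is_path H u v p -> is_path G u v p.
Proof.
move=> sHG /and4P[uH ph lp up]; apply/and4P; split=> //.
  by case: sHG => /subsetP sV _; apply: sV.
by apply: sub_path ph; apply: subgraph_adj.
Qed.

Definition adj_off G A : rel T :=
  [rel x y | [&& adj G x y, x \notin A & y \notin A]].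

Lemma connect_off_sym G A : connect_sym (adj_off G A).
Proof.
by apply: sym_connect_sym => x y; rewrite /adj_off /= adj_sym (andbC (x \notin A)).
Qed.

Lemma connect_off_walk G A x p :
  path (adj G) x p -> all [predC A] (x :: p) ->
  connect (adj_off G A) x (last x p).
Proof.
move=> php offp; apply/connectP; exists p => //.
elim: p x php offp => //= a p IHp x /andP[xa php] /and3P[xA aA offp].
apply/andP; split; first by apply/and3P.
by apply: IHp => //=; rewrite aA.
Qed.

Lemma connect_off_path G A x y :
    x \in vertices G -> x \notin A -> connect (adj_off G A) x y ->
  exists2 p, is_path G x y p & all [predC A] (x :: p).
Proof.
move=> xV xA /connectP[p0 + ->] => /shortenP[p php up _].
exists p.
  apply/and4P; split=> //.
  by apply: sub_path php => a b /and3P[].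
rewrite /= xA /=; elim: p x php {xV xA up} => //= a p IHp x /andP[/and3P[_ _ aA] php].
by rewrite aA (IHp a).
Qed.

(** A boolean form of [connected_no_cutpoint], so that maximal sets of vertices
    inducing such a graph can be chosen effectively.  Letting [A] be empty or a
    singleton treats connectedness and the absence of cutpoints together. *)
Definition nonseparable G : bool :=
  (vertices G != set0) &&
  [forall A : {set T}, (#|A| <= 1) ==>
    [forall x in vertices G :\: A, forall y in vertices G :\: A,
       connect (adj_off G A) x y]].

Lemma nonseparable_connect G A x y :
    nonseparable G -> #|A| <= 1 -> x \in vertices G -> x \notin A ->
    y \in vertices G -> y \notin A ->
  connect (adj_off G A) x y.
Proof.
case/andP=> _ /forallP/(_ A)/implyP nsG /nsG/forall_inP {}nsG xV xA yV yA.
have /forall_inP-> // : [forall y in vertices G :\: A, connect (adj_off G A) x y].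
  by apply: nsG; rewrite inE xA.
by rewrite inE yA.
Qed.

Lemma nonseparableP G : reflect (connected_no_cutpoint G) (nonseparable G).
Proof.
apply: (iffP idP) => [nsG | [[V0 connG] nocut]].
  split; first split; first by case/andP: nsG.
    move=> u v uV vV.
    have cuv: connect (adj_off G set0) u v.
      by apply: nonseparable_connect; rewrite ?cards0 ?inE.
    have [|p pp _] := connect_off_path uV _ cuv; first by rewrite inE.
    by exists p.
  move=> c [_ [x [y [xc yc [p pp] thru]]]].
  have [xV php /eqP lp _] := and4P pp.
  have yV : y \in vertices G.
    by apply: (walk_vertices xV php); rewrite -lp mem_last.
  have cxy: connect (adj_off G [set c]) x y.
    by apply: nonseparable_connect; rewrite ?cards1 ?inE.
  have [|q qq /allP offq] := connect_off_path xV _ cxy; first by rewrite inE.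
  by have := offq c (thru q qq); rewrite !inE eqxx.
apply/andP; split=> //; apply/forallP=> A; apply/implyP=> cardA.
apply/forall_inP=> x; rewrite inE => /andP[xA xV].
apply/forall_inP=> y; rewrite inE => /andP[yA yV].
apply: contraT => sep.
(* As [A] separates [x] from [y], it is not empty: it is a single vertex, and
   every path from [x] to [y] meets it. *)
have thru p : is_path G x y p -> ~~ all [predC A] (x :: p).
  case/and4P=> _ php /eqP lp _; apply: contra sep => offp.
  by rewrite -lp connect_off_walk.
have [p pp] := connG x y xV yV.
have /allPn[c cp /negPn/= cA] := thru p pp.
have Ac: A = [set c].
  by apply/esym/eqP; rewrite eqEcard sub1set cA cards1.
case: (nocut c); split.
  by have [_ php _ _] := and4P pp; apply: (walk_vertices xV php).
exists x, y; split; first by apply: contraNneq xA => ->.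
- by apply: contraNneq yA => ->.
- by exists p.
move=> q /thru/allPn[d dq /negPn/=].
by rewrite Ac inE => /eqP <-.
Qed.

(** * Induced subgraphs and the absorption of paths by blocks *)

Definition induced_edges G A := [set e in edges G | e \subset vertices G :&: A].

Lemma induced_proof G A :
  [forall e in induced_edges G A,
     (#|e| == 2) && (e \subset vertices G :&: A)].
Proof.
apply/forall_inP=> e; rewrite inE => /andP[eG ->]; rewrite andbT.
by case: G eG => V E /= /forall_inP axE /axE /andP[].
Qed.

(** [A] need not consist of vertices of [G], which makes [induced G] total and
    spares side conditions on unions of vertex sets. *)
Definition induced G A := Graph (induced_proof G A).

Lemma induced_sub G A : subgraph (induced G A) G.
Proof.
split; first exact: subsetIl.
by apply/subsetP=> e; rewrite inE => /andP[].
Qed.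

Lemma adj_induced G A x y :
  adj (induced G A) x y = [&& adj G x y, x \in A & y \in A].
Proof.
rewrite {1}/adj /= inE subUset !sub1set !inE.
apply/andP/and3P => [[xy /andP[/andP[_ xA] /andP[_ yA]]] // | [xy xA yA]].
by have [xV yV] := adj_vertices xy; rewrite xV yV xA yA.
Qed.

Lemma path_induced G A u p :
    path (adj G) u p -> {subset u :: p <= A} ->
  path (adj (induced G A)) u p.
Proof.
elim: p u => //= a p IHp u /andP[ua php] sub.
rewrite adj_induced ua !sub ?inE ?eqxx ?orbT //=.
by apply: IHp => // x xp; apply: sub; rewrite inE xp orbT.
Qed.

Lemma sub_induced H G A :
  subgraph H G -> vertices H \subset A -> subgraph H (induced G A).
Proof.
case=> sV sE sA; split; first by rewrite subsetI sV.
apply/subsetP=> e eH; rewrite inE (subsetP sE) //= subsetI.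
by rewrite !(subset_trans (edge_sub eH)).
Qed.

Lemma subgraph_connect_off H G A :
  subgraph H G -> subrel (connect (adj_off H A)) (connect (adj_off G A)).
Proof.
move=> sHG; apply: connect_sub => x y /and3P[xy xA yA].
by apply: connect1; apply/and3P; split=> //; apply: subgraph_adj xy.
Qed.

(** The common pattern behind the preservation of nonseparability: the graph
    may grow as long as no deletion of a vertex cuts a new vertex from [H]. *)
Lemma nonseparable_attach H G :
    subgraph H G -> nonseparable H ->
    (forall A x, #|A| <= 1 -> x \in vertices G -> x \notin A ->
       exists2 h, h \in vertices H :\: A & connect (adj_off G A) x h) ->
  nonseparable G.
Proof.
move=> sHG nsH attach; apply/andP; split.
  have [sV _] := sHG; have [/set0Pn[h hH] _] := andP nsH.
  by apply/set0Pn; exists h; apply: (subsetP sV).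
apply/forallP=> A; apply/implyP=> cardA.
apply/forall_inP=> x; rewrite inE => /andP[xA xV].
apply/forall_inP=> y; rewrite inE => /andP[yA yV].
have [h /setDP[hH hA] xh] := attach A x cardA xV xA.
have [k /setDP[kH kA] yk] := attach A y cardA yV yA.
apply: connect_trans xh _; rewrite connect_off_sym.
apply: connect_trans yk _; apply: (subgraph_connect_off sHG).
exact: nonseparable_connect.
Qed.

Lemma nonseparable_induced H G :
  subgraph H G -> nonseparable H -> nonseparable (induced G (vertices H)).
Proof.
move=> sHG nsH; apply: nonseparable_attach nsH _; first exact: sub_induced.
move=> A x _; rewrite inE => /andP[_ xH] xA.
by exists x; rewrite ?inE ?xA.
Qed.

(** A deleted vertex other than [x] lies on at most one side of [x] along the
    path [p], so the other side still leads from [x] to an end in [H]. *)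
Lemma nonseparable_add_path H G u v p :
    subgraph H G -> nonseparable H -> u \in vertices H -> v \in vertices H ->
    is_path G u v p ->
  nonseparable (induced G (vertices H :|: [set x in u :: p])).
Proof.
set W := _ :|: _ => sHG nsH uH vH /and4P[uG php /eqP lp up].
apply: nonseparable_attach nsH _; first exact/sub_induced/subsetUl.
move=> A x cardA; rewrite inE => /andP[_ /setUP[xH|xp]] xA.
  by exists x; rewrite ?inE ?xA.
rewrite inE in xp.
have phW : path (adj (induced G W)) u p.
  by apply: path_induced => // y yp; rewrite !inE in yp *; rewrite yp orbT.
case/splitPl: xp phW lp up => p1 p2 lp1.
rewrite cat_path last_cat lp1 => /andP[ph1 ph2] lp2 up.
have [off2|] := boolP (all [predC A] (x :: p2)).
  exists v; last by rewrite -lp2 connect_off_walk.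
  by rewrite inE vH andbT; have:= allP off2 v; rewrite -lp2 mem_last; apply.
case/allPn=> c cp2 /negPn/= cA.
have off1: all [predC A] (u :: p1).
  apply/allP=> d dp1; apply/negP=> /= dA.
  have dc: d = c by apply: (card_le1_eqP cardA).
  have cp: c \in p2.
    by move: cp2; rewrite inE => /predU1P[cx|//]; rewrite cx (negPf xA) in cA.
  move: up; rewrite -cat_cons cat_uniq => /and3P[_ /hasPn/(_ c cp)/negP + _].
  by rewrite -dc.
exists u; first by rewrite inE uH andbT; have /andP[] := off1.
by rewrite connect_off_sym -lp1 connect_off_walk.
Qed.

(** By maximality the block contains the subgraph induced by its own vertices
    and those of the path, because that subgraph is nonseparable. *)
Lemma block_path B G u v p :
    is_block B G -> u \in vertices B -> v \in vertices B ->
  is_path B u v p = is_path G u v p.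
Proof.
move=> [sBG nsB maxB] uB vB; apply/idP/idP; first exact: subgraph_path.
move=> pp; set W := vertices B :|: [set x in u :: p].
have sKB: subgraph (induced G W) B.
  apply: maxB; first exact: induced_sub.
    apply/nonseparableP; apply: nonseparable_add_path pp => //.
    exact/nonseparableP.
  exact/sub_induced/subsetUl.
apply: subgraph_path sKB _; have [uG php lp up] := and4P pp.
apply/and4P; split=> //; first by rewrite !inE uG eqxx orbT.
by apply: path_induced => // y yp; rewrite !inE in yp *; rewrite yp orbT.
Qed.

Lemma edge_nonseparable G a b :
  adj G a b -> nonseparable (induced G [set a; b]).
Proof.
move=> ab; have [aG bG] := adj_vertices ab.
have ab' : adj (induced G [set a; b]) a b by rewrite adj_induced ab !inE !eqxx orbT.
apply/andP; split; first by apply/set0Pn; exists a; rewrite !inE aG eqxx.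
apply/forallP=> A; apply/implyP=> cardA.
apply/forall_inP=> x; rewrite inE => /andP[xA]; rewrite !inE => /andP[_ xab].
apply/forall_inP=> y; rewrite inE => /andP[yA]; rewrite !inE => /andP[_ yab].
have [-> //|xy] := eqVneq x y.
apply: connect1; apply/and3P; split=> //.
by case/pred2P: xab xy => ->; case/pred2P: yab => ->; rewrite ?eqxx // adj_sym.
Qed.

(** Only induced subgraphs compete for maximality: passing from a nonseparable
    subgraph to the one induced by its vertices only adds edges, which keeps it
    nonseparable.  A maximal set of vertices therefore gives a block. *)
Lemma nonseparable_in_block H G :
    subgraph H G -> nonseparable H ->
  exists2 B, is_block B G & subgraph H B.
Proof.
move=> sHG nsH; pose P A := (A \subset vertices G) && nonseparable (induced G A).
have [A maxA sHA] : {A | maxset P A & vertices H \subset A}.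
  by apply: maxset_exists; rewrite /P nonseparable_induced // andbT; case: sHG.
have [/andP[sAG nsA] supA] := maxsetP maxA.
exists (induced G A); last exact: sub_induced.
split; [exact: induced_sub | exact/nonseparableP |].
move=> K sKG /nonseparableP nsK [/= sAK _]; apply: sub_induced => //.
rewrite (supA (vertices K)) //; last by rewrite (setIidPr sAG) in sAK.
by rewrite /P nonseparable_induced // andbT; case: sKG.
Qed.

Lemma edge_in_block G a b :
  adj G a b -> exists2 B, is_block B G & adj B a b.
Proof.
move=> ab.
have [B blkB sB] := nonseparable_in_block (induced_sub _ _) (edge_nonseparable ab).
exists B => //; apply: subgraph_adj sB _ _ _.
by rewrite adj_induced ab !inE !eqxx orbT.
Qed.

Lemma block_path_closed B G u v p :
    is_block B G -> u \in vertices B -> v \in vertices B -> is_path G u v p ->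
  {subset u :: p <= vertices B}.
Proof.
move=> blkB uB vB; rewrite -(block_path p blkB) // => /and4P[_ + _ _].
exact: walk_vertices.
Qed.

(** * Shortest paths *)

Definition geodesic G u v p := is_path G u v p && (size p == dist G u v).

Lemma size_path_lt G u v p : is_path G u v p -> size p < #|T|.
Proof.
by case/and4P=> _ _ _ up; have := max_card [in u :: p]; rewrite (card_uniqP up).
Qed.

Lemma dist_le_path G u v p : is_path G u v p -> dist G u v <= size p.
Proof.
move=> pp; have ltpT := size_path_lt pp.
rewrite leqNgt; apply/negP => ltpd.
have := before_find 0 ltpd; rewrite nth_iota // add0n => /existsP; case.
by exists (in_tuple p).
Qed.

Lemma dist_le_walk G u p :
  u \in vertices G -> path (adj G) u p -> dist G u (last u p) <= size p.
Proof.
move=> uG; case/shortenP=> q phq uq sqp.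
apply: (@leq_trans (size q)); first by apply: dist_le_path; apply/and4P.
by apply: uniq_leq_size => //; case/andP: uq.
Qed.

Lemma geodesic_exists G u v p : is_path G u v p -> exists q, geodesic G u v q.
Proof.
move=> pp; have ltpT := size_path_lt pp.
have: has (fun n => [exists q : n.-tuple T, is_path G u v q]) (iota 0 #|T|).
  apply/hasP; exists (size p); first by rewrite mem_iota.
  by apply/existsP; exists (in_tuple p).
move=> hasn; have := nth_find 0 hasn; rewrite nth_iota; last first.
  by rewrite -{2}(size_iota 0 #|T|) -has_find.
by case/existsP=> q pq; exists q; rewrite /geodesic pq size_tuple eqxx.
Qed.

(** A shorter path for one of the two pieces, put together with the other piece,
    would give a walk from [u] to [v] shorter than the distance. *)
Lemma geodesic_cat G u v p q :
    geodesic G u v (p ++ q) ->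
  geodesic G u (last u p) p /\ geodesic G (last u p) v q.
Proof.
case/andP=> /and4P[uG]; rewrite cat_path last_cat -cat_cons cat_uniq.
case/andP=> php phq /eqP lq /and3P[up disj uq]; rewrite size_cat => /eqP dpq.
set w := last u p in phq lq *.
have wG: w \in vertices G by apply: (walk_vertices uG php); exact: mem_last.
have pp: is_path G u w p by apply/and4P.
have pq: is_path G w v q.
  apply/and4P; split=> //; first exact/eqP.
  rewrite /= uq andbT; apply: contra disj => wq.
  by apply/hasP; exists w; rewrite // mem_last.
have le_cat p' q' : is_path G u w p' -> is_path G w v q' ->
    size p + size q <= size p' + size q'.
  move=> /and4P[_ php' /eqP lp' _] /and4P[_ phq' /eqP lq' _].
  rewrite dpq -size_cat -lq' -lp' -last_cat; apply: dist_le_walk => //.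
  by rewrite cat_path php' lp'.
split; apply/andP; split=> //; rewrite eqn_leq dist_le_path // andbT.
  have [p' /andP[pp' /eqP <-]] := geodesic_exists pp.
  by rewrite -(leq_add2r (size q)) le_cat.
have [q' /andP[pq' /eqP <-]] := geodesic_exists pq.
by rewrite -(leq_add2l (size p)) le_cat.
Qed.

Lemma geodesic_nil G u q : geodesic G u u q -> q = [::].
Proof.
case/andP=> /and4P[_ _ /eqP lq /=]; case: q lq => //= a q lq /andP[+ _] _.
by rewrite -{1}lq mem_last.
Qed.

Lemma block_geodesic B G u v p :
    is_block B G -> u \in vertices B -> v \in vertices B ->
  geodesic B u v p = geodesic G u v p.
Proof.
move=> blkB uB vB; rewrite /geodesic (block_path p blkB) //.
congr (_ && (_ == _)); apply: eq_find => n.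
by apply: eq_existsb => q; apply: block_path.
Qed.

Lemma path_rev G u p : path (adj G) (last u p) (rev (belast u p)) = path (adj G) u p.
Proof. by rewrite rev_path; apply: eq_path => x y; apply: adj_sym. Qed.

(** The block is the one of the first edge [ua] of [p].  As [p] and [q] meet only
    at their ends, [q] followed by the reverse of [p] down to [a] repeats no
    vertex; it is a path from [u] to [a] through [v]. *)
Lemma disjoint_geodesics_in_block G u v p q :
    geodesic G u v p -> geodesic G u v q -> u != v ->
    (forall w, w \in p -> w \in q -> w = v) ->
  exists B, [/\ is_block B G, u \in vertices B & v \in vertices B].
Proof.
case: p => [|a p]; first by case/andP=> /and4P[_ _ /= /eqP-> _] _ _; rewrite eqxx.
case/andP=> /and4P[uG /andP[ua php] /eqP lp]; rewrite cons_uniq => up _; rewrite /= in lp.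
case/andP=> /and4P[_ phq /eqP lq uq] _ neq_uv disj.
have [B blkB uaB] := edge_in_block ua; exists B.
have [uB aB] := adj_vertices uaB; split=> //.
have pr: is_path G u a (q ++ rev (belast a p)).
  apply/and4P; split=> //.
  - by rewrite cat_path phq lq -lp path_rev.
  - rewrite last_cat lq; case: (p) lp => [/= ->|b r _]; first by rewrite eqxx.
    by rewrite /= rev_cons last_rcons.
  rewrite -cat_cons cat_uniq uq rev_uniq; move: up.
  rewrite (lastI a p) lp rcons_uniq mem_rcons inE negb_or.
  case/and3P=> /= /andP[_ up] vp ->; rewrite andbT.
  apply/hasPn=> w; rewrite mem_rev => wp /=; rewrite inE negb_or.
  rewrite (contraNneq _ up) => [|<-//] /=.
  apply/negP=> wq; suff wv: w = v by rewrite -wv wp in vp.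
  by apply: disj => //; rewrite lastI mem_rcons inE wp orbT.
apply: (block_path_closed blkB uB aB pr).
by rewrite -cat_cons mem_cat -lq mem_last.
Qed.

End Graphs.

(** * Signs of shortest paths *)

Section SignedGraphs.

Variable T : finType.
Implicit Types (S B : signed_graph T) (u v w x y : T) (p q : seq T).

Local Open Scope ring_scope.

Lemma path_sign_cat S u p q :
  path_sign S u (p ++ q) = path_sign S u p * path_sign S (last u p) q.
Proof. by rewrite /path_sign pairmap_cat big_cat. Qed.

Lemma signature_pm1 S e :
  e \in edges S -> signature S e = 1 \/ signature S e = -1.
Proof. by case: S => G sg sgP; apply: sgP. Qed.

Lemma path_sign_pm1 S u p :
  path (adj S) u p -> path_sign S u p = 1 \/ path_sign S u p = -1.
Proof.
rewrite /path_sign; elim: p u => [|a p IHp] u /=; first by rewrite big_nil; left.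
case/andP=> ua /IHp; rewrite big_cons.
move/signature_pm1: ua.
by move=> [] -> [] ->; rewrite ?mul1r ?mulN1r ?opprK; [left|right|right|left].
Qed.

Lemma eq_path_sign B S u p :
    {in edges B, signature B =1 signature S} -> path (adj B) u p ->
  path_sign B u p = path_sign S u p.
Proof.
rewrite /path_sign => eqBS; elim: p u => [|a p IHp] u /=; first by rewrite !big_nil.
by case/andP=> ua php; rewrite !big_cons eqBS // IHp.
Qed.

Lemma forall_geodesicP S u v (P : pred (seq T)) :
  reflect (forall p, geodesic S u v p -> P p)
    [forall p : (dist S u v).-tuple T, is_path S u v p ==> P p].
Proof.
apply: (iffP forallP) => [allP p /andP[pp sp] | allP p].
  exact: (implyP (allP (Tuple sp))).
by apply/implyP=> pp; apply: allP; rewrite /geodesic pp size_tuple eqxx.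
Qed.

Definition cosigned_geodesics S u v : Prop :=
  forall p q, geodesic S u v p -> geodesic S u v q ->
    path_sign S u p = path_sign S u q.

(** Equal signed distances force equal signs unless the distance is zero, where
    the empty path is the only shortest path.  The existence of a path excludes
    the vacuous case, in which [sigma_min] is 1 and [sigma_max] is -1. *)
Lemma vertices_distance_compatibleP S u v p0 :
    is_path S u v p0 ->
  vertices_distance_compatible S u v <-> cosigned_geodesics S u v.
Proof.
case/geodesic_exists=> {p0} p0 gp0.
rewrite /vertices_distance_compatible /d_min /d_max.
have all_pos := forall_geodesicP S u v (fun p => path_sign S u p == 1).
have all_neg := forall_geodesicP S u v (fun p => path_sign S u p == -1).
split=> [eqd p q gp gq | eqs].
  have [/andP[_ /eqP sp] /andP[_ /eqP sq]] := (gp, gq).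
  have [d0|d_neq0] := eqVneq (dist S u v) 0%N.
    by move: sp sq; rewrite d0 => /size0nil-> /size0nil->.
  have: sigma_min S u v = sigma_max S u v.
    by apply: mulIf eqd; rewrite (eqz_nat _ 0).
  rewrite /sigma_min /sigma_max.
  case: all_pos => [all1 _|_].
    by rewrite (eqP (all1 p gp)) (eqP (all1 q gq)).
  case: all_neg => [allN _|//].
  by rewrite (eqP (allN p gp)) (eqP (allN q gq)).
congr (_ * _); rewrite /sigma_min /sigma_max.
have [/and4P[_ php0 _ _] _] := andP gp0.
case: all_pos => [all1|not1]; case: all_neg => [allN|notN] //.
  by have := allN p0 gp0; rewrite (eqP (all1 p0 gp0)).
have [s1|sN] := path_sign_pm1 php0.
  by case: not1 => p gp; rewrite (eqs _ _ gp gp0) s1.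
by case: notN => p gp; rewrite (eqs _ _ gp gp0) sN.
Qed.

Lemma distance_compatibleP S :
  connected S ->
  distance_compatible S <-> forall u v, cosigned_geodesics S u v.
Proof.
case=> _ connS; split=> [dcS u v p q gp | eqs u v uS vS].
  have [pp _] := andP gp; have [uS php /eqP lp _] := and4P pp.
  have vS: v \in vertices S by rewrite -lp (walk_vertices uS php) ?mem_last.
  exact: (vertices_distance_compatibleP pp).1 (dcS u v uS vS) p q gp.
have [p pp] := connS u v uS vS.
by apply: (vertices_distance_compatibleP pp).2; apply: eqs.
Qed.

Lemma signed_subgraph_proof S (H : graph T) :
    subgraph H S ->
  forall e, e \in edges H -> signature S e = 1 \/ signature S e = -1.
Proof. by case=> _ /subsetP sE e /sE; apply: signature_pm1. Qed.

Definition signed_subgraph S (H : graph T) (sHS : subgraph H S) :=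
  SignedGraph (signed_subgraph_proof sHS).

(** Strong induction on the length of [p], splitting both paths at a common inner
    vertex as long as there is one. *)
Lemma cosigned_geodesics_of_blocks S :
    (forall B u v, is_signed_block B S -> cosigned_geodesics B u v) ->
  forall u v, cosigned_geodesics S u v.
Proof.
move=> blocks u v p; have [n] := ubnP (size p).
elim: n u v p => // n IHn u v p ltpn q gp gq.
have [uv|neq_uv] := eqVneq u v.
  by rewrite -uv in gp gq; rewrite (geodesic_nil gp) (geodesic_nil gq).
have [/hasP[w wp /andP[/= wq neq_wv]]|disj] :=
    boolP (has (fun w => (w \in q) && (w != v)) p).
  case/splitPr: wp gp ltpn => p1 p2; case/splitPr: wq gq => q1 q2.
  rewrite -!cat_rcons => /geodesic_cat[gq1 gq2] /geodesic_cat[gp1 gp2].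
  rewrite !path_sign_cat size_cat !last_rcons in gp1 gp2 gq1 gq2 * => ltn.
  have p2_gt0 : (0 < size p2)%N.
    by case: (p2) gp2 => //; case/andP=> /and4P[_ _ /=]; rewrite (negPf neq_wv).
  congr (_ * _); first apply: IHn gp1 gq1.
    by rewrite -ltnS; apply: leq_trans ltn; rewrite -addn1 ltnS leq_add2l.
  apply: IHn gp2 gq2; rewrite -ltnS; apply: leq_trans ltn.
  by rewrite size_rcons addSn !ltnS leq_addl.
have [w wp wq|B [blkB uB vB]] := disjoint_geodesics_in_block gp gq neq_uv.
  by apply/eqP; apply: contraNT disj => neq_wv; apply/hasP; exists w; rewrite ?wq.
have [sBS _ _] := blkB.
have gB r : geodesic S u v r -> geodesic B u v r by rewrite (block_geodesic r blkB).
exact: (blocks (signed_subgraph sBS) u v _ p q (gB p gp) (gB q gq)).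
Qed.

End SignedGraphs.

Theorem theorem5p3 (T : finType) (S : signed_graph T) :
  connected S ->
  (distance_compatible S <->
   forall B : signed_graph T, is_signed_block B S -> distance_compatible B).
Proof.
move=> connS; have dcS := distance_compatibleP connS.
have connB (B : signed_graph T) : is_signed_block B S -> connected B.
  by case=> [[_ []]].
split=> [/dcS eqs B sblkB | blocks].
  have [blkB eqBS] := sblkB.
  apply/(distance_compatibleP (connB B sblkB)) => u v p q gp gq.
  have [/and4P[uB php /eqP lp _] _] := andP gp.
  have [/and4P[_ phq _ _] _] := andP gq.
  have vB: v \in vertices B by rewrite -lp (walk_vertices uB php) ?mem_last.
  rewrite !(eq_path_sign eqBS) //.
  by apply: (eqs u v); rewrite -(block_geodesic _ blkB).
apply/dcS/cosigned_geodesics_of_blocks => B u v sblkB.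
exact: (distance_compatibleP (connB B sblkB)).1 (blocks B sblkB) u v.
Qed.
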